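(* Let $1<p<\infty$ and set $$\alpha_p=\begin{cases}2,&1<p\le 2,\\ p,&2<p<\infty,\end{cases}\qquad c_p=\begin{cases}\dfrac{p-1}{4},&1<p\le 2,\\[4pt] \dfrac{1-2^{1-p}}{p},&2<p<\infty.\end{cases}$$ Let $(X,\mu)$ be a measure space and let $f,g\in L^p(X,\mu)$ be nonzero and nonnegative. Then $$\|f+g\|_p\le \|f\|_p+\|g\|_p-c_p\,\min\{\|f\|_p,\|g\|_p\}\,\left\|\frac{f}{\|f\|_p}-\frac{g}{\|g\|_p}\right\|_p^{\alpha_p}.$$ Moreover, the constant $c_p$ is best possible in each of the two ranges: for every $p\in(1,\infty)$, there is no constant $c>c_p$ such that the inequality $$\|f+g\|_p\le \|f\|_p+\|g\|_p-c\,\min\{\|f\|_p,\|g\|_p\}\,\left\|\frac{f}{\|f\|_p}-\frac{g}{\|g\|_p}\right\|_p^{\alpha_p}$$ (with the same exponent $\alpha_p$) holds for all measure spaces $(X,\mu)$ and all nonzero nonnegative $f,g\in L^p(X,\mu)$.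
   Context: $\|h\|_p=\left(\int_X |h|^p\,d\mu\right)^{1/p}$ denotes the usual $L^p$ norm. Functions are real-valued. ''Nonzero'' means nonzero as an element of $L^p(X,\mu)$, i.e. $\|f\|_p,\|g\|_p>0$; ''nonnegative'' means $f,g\ge 0$ ($\mu$-almost everywhere). *)

(* Defs.v *)
From HB Require Import structures.
From mathcomp Require Import all_boot all_order all_algebra.
From mathcomp Require Import all_classical all_reals all_analysis.
Set Implicit Arguments.
Unset Strict Implicit.
Unset Printing Implicit Defensive.
Import Order.TTheory GRing.Theory Num.Theory.
Import numFieldNormedType.Exports.
Local Open Scope classical_set_scope.
Local Open Scope ring_scope.

(* [fine] sends an infinite norm to 0, so this is the L^p norm only for
   functions in [Lfun mu p%:E]; f + g and f / a - g / b stay in that space. *)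
Definition Lpnorm d (T : measurableType d) (R : realType)
    (mu : {measure set T -> \bar R}) (p : R) (f : T -> R) : R :=
  fine ('N[mu]_(p%:E)[EFin \o f])%E.

Definition alpha_p (R : realType) (p : R) : R := if p <= 2 then 2 else p.

Definition c_p (R : realType) (p : R) : R :=
  if p <= 2 then (p - 1) / 4 else (1 - 2 `^ (1 - p)) / p.

Definition refined_minkowski d (T : measurableType d) (R : realType)
    (mu : {measure set T -> \bar R}) (p c : R) (f g : T -> R) : Prop :=
  Lpnorm mu p (fun x => f x + g x) <=
    Lpnorm mu p f + Lpnorm mu p g
    - c * Num.min (Lpnorm mu p f) (Lpnorm mu p g)
      * Lpnorm mu p (fun x => f x / Lpnorm mu p f - g x / Lpnorm mu p g)
        `^ alpha_p p.

(* Main.v *)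
Require Import Defs.
From HB Require Import structures.
From mathcomp Require Import all_boot all_order all_algebra.
From mathcomp Require Import all_classical all_reals all_analysis.
From mathcomp Require Import measurable_realfun.
From mathcomp Require Import ring lra.
Import Order.TTheory GRing.Theory Num.Theory.
Import numFieldNormedType.Exports.
Local Open Scope classical_set_scope.
Local Open Scope ring_scope.

(** Write [A = ||f||], [B = ||g||] with [B <= A], [u = f / A] and [v = g / B].
Since [f + g = (A - B) u + B (u + v)], Minkowski's inequality reduces the bound
to unit vectors: [||u + v|| <= 2 - c_p ||u - v||^alpha_p]
([Lpnorm_unit_le]).  Put [S = ||u + v||], [E = ||u - v||].

A scalar inequality [C1 + C2 t^p <= (1 + t)^p + (1 - t)^p] on [0 <= t <= 1]
extends by homogeneity to pairs of nonnegative reals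
([two_point_homogeneous]), and integrates to
[C1 S^p + C2 E^p <= 2^p (||u||^p + ||v||^p) = 2^(p + 1)] ([Lpnorm_two_point]).
- For [p >= 2] the choice [C1 = 2], [C2 = 2^p - 2] is admissible
  ([two_point_ge2]).
- For [1 < p <= 2] one has [2 + p (p - 1) t^2 <= (1 + t)^p + (1 - t)^p]
  ([two_point_le2]).  As [t^p] is a concave function of [t^2], the quadratic
  term can be bounded from below by an affine function of [t^p], namely its
  tangent at [rho = E / S] ([powR_le_tangent]); at this value of [rho] nothing
  is lost after integration, and since [S <= 2] one gets
  [(S/2)^p + p (p - 1) E^2 / 8 <= 1].
In both cases Bernoulli's inequality [1 + p (S/2 - 1) <= (S/2)^p] concludes.

Optimality is tested on finitely supported sequences with the counting measure.
For [p <= 2] take [f = (1 + t, 1 - t)] and [g = (1 - t, 1 + t)] with [t] small,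
and compare with the second order upper bound [two_point_le2_upper].
For [p > 2] take [f = (a, b, 0)] and [g = (a, 0, b)] with [a^p = 1 - s],
[b^p = s] and [s] small. *)

Set Implicit Arguments.
Unset Strict Implicit.
Unset Printing Implicit Defensive.

(** * Bernoulli inequalities for real exponents *)

Section bernoulli.
Variable R : realType.
Implicit Types p r x : R.

(** This is Young's inequality for the pair [x], [1]. *)
Lemma powR_ge_bernoulli p x : 1 <= p -> 0 <= x -> 1 + p * (x - 1) <= x `^ p.
Proof.
rewrite le_eqVlt => /predU1P[<-|p1] x0; first by rewrite powRr1//; lra.
have p0 : 0 < p by lra.
have q0 : 0 < p / (p - 1) by rewrite divr_gt0//; lra.
have pq : p^-1 + (p / (p - 1))^-1 = 1 by field; lra.
have := @conjugate_powR R x 1 p (p / (p - 1)) x0 ler01 p0 q0 pq.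
rewrite mulr1 powR1.
have -> : 1 / (p / (p - 1)) = (p - 1) / p by field; lra.
rewrite -mulrDl ler_pdivlMr//; lra.
Qed.

Lemma powR_le_bernoulli r x :
  0 <= r -> r <= 1 -> 0 <= x -> x `^ r <= 1 + r * (x - 1).
Proof.
rewrite le_eqVlt => /predU1P[<- _ _|r0 r1 x0]; first by rewrite powRr0; lra.
have ri : 1 <= r^-1 by rewrite invf_ge1.
have := powR_ge_bernoulli ri (powR_ge0 x r).
rewrite -powRrM mulfV ?gt_eqF// powRr1// -(ler_pM2l r0) mulrDr mulrA mulfV ?gt_eqF//.
lra.
Qed.

Lemma powRN_ge_bernoulli r x :
  0 <= r -> r <= 1 -> 0 < x -> 1 - r * (x - 1) <= x `^ (- r).
Proof.
move=> r0 r1 x0; have h := powR_le_bernoulli r0 r1 (ltW x0).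
(* [(1 - k) (1 + k) <= 1] with [k = r (x - 1)]. *)
rewrite powRN -[leRHS]mul1r ler_pdivlMr ?powR_gt0//.
have [y0|y0] := leP (1 - r * (x - 1)) 0.
  by rewrite (le_trans _ ler01)// mulr_le0_ge0// powR_ge0.
apply: (le_trans (ler_wpM2l (ltW y0) h)).
by have := sqr_ge0 (r * (x - 1)); lra.
Qed.

End bernoulli.

(** * Monotonicity and continuity of power functions *)

Section monotone.
Variable R : realType.

Lemma is_derive_ge0_le (f df : R -> R) (a b : R) : a <= b ->
  (forall x, x \in `]a, b[ -> is_derive x 1 f (df x)) ->
  (forall x, x \in `]a, b[ -> 0 <= df x) ->
  {within `[a, b], continuous f} -> f a <= f b.
Proof.
rewrite le_eqVlt => /predU1P[->//|ab] fdf df0 cf.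
have [c cab E] := MVT ab fdf cf.
by rewrite -subr_ge0 E mulr_ge0 ?df0// subr_ge0 ltW.
Qed.

(** The absolute value matters: [x `^ p] is [1] for [x < 0], hence
    discontinuous at [0]. *)
Lemma continuous_normr_powR (p : R) : 0 < p ->
  continuous (fun x : R => `|x| `^ p).
Proof.
move=> p0 x; have [->|x0] := eqVneq x 0.
  rewrite /continuous_at normr0 powR0 ?gt_eqF//.
  apply/cvgrPdist_lt => e e0; near=> y.
  rewrite sub0r normrN ger0_norm ?powR_ge0//.
  have -> : e = (e `^ p^-1) `^ p by rewrite -powRrM mulVf ?gt_eqF// powRr1// ltW.
  rewrite gt0_ltr_powR// ?nnegrE ?powR_ge0//.
  near: y; apply: cvgr0_norm_lt => //; rewrite ?powR_gt0//.
apply: (@continuous_comp _ _ _ (fun x : R => `|x|) (fun y => y `^ p)).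
  exact: norm_continuous.
apply: differentiable_continuous; apply/derivable1_diffP.
by apply: derivable_powR; rewrite in_itv/= andbT normr_gt0.
Unshelve. all: by end_near. Qed.

Lemma within_continuous_powR (p : R) (f : R -> R) (a b : R) : 0 < p ->
  continuous f -> {in `[a, b], forall x, 0 <= f x} ->
  {within `[a, b], continuous (fun x => f x `^ p)}.
Proof.
move=> p0 cf f0; apply: (@subspace_eq_continuous _ _ _ (fun x => `|f x| `^ p)).
  by move=> x; rewrite inE => /f0 fx; rewrite ger0_norm.
apply: continuous_subspaceT => x.
apply: (@continuous_comp _ _ _ f (fun y => `|y| `^ p)); first exact: cf.
exact: continuous_normr_powR.
Qed.

End monotone.

(** * Two-point inequalities *)

Section two_point.
Variable R : realType.
Implicit Types p q t e K : R.

Lemma is_derive_powR_comp (f : R -> R) (df p x : R) : 0 < f x -> is_derive x 1 f df ->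
  is_derive x 1 (fun y => f y `^ p) (p * f x `^ (p - 1) * df).
Proof.
move=> fx fdf.
have H := is_derive1_powR p fx.
apply: is_derive_eq.
  exact: (@is_derive1_comp _ (fun y => y `^ p) f).
by rewrite mulrC.
Qed.

(** The hypothesis bounds from below the derivative of the right-hand side, whose
    value at [0] is [2 * e].  The sign of [e] is free, so that lower ([e = 1])
    and upper ([e = -1]) bounds of the symmetric sum are both covered. *)
Lemma symm_powR_ge e K p t : 0 < p -> 0 <= t -> t <= 1 ->
  (forall s, 0 < s < t ->
     0 <= e * (p * ((1 + s) `^ (p - 1) - (1 - s) `^ (p - 1))) + K * (2 * s)) ->
  2 * e <= e * ((1 + t) `^ p + (1 - t) `^ p) + K * t ^+ 2.
Proof.
move=> p0 t0 t1 H.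
pose F (s : R) := e * ((1 + s) `^ p + (1 - s) `^ p) + K * s ^+ 2.
have : F 0 <= F t; last first.
  by rewrite /F addr0 subr0 powR1 expr0n/= mulr0 addr0 mulrC.
apply: (@is_derive_ge0_le _ _
  (fun s => e * (p * ((1 + s) `^ (p - 1) - (1 - s) `^ (p - 1))) + K * (2 * s)))
  => //.
- move=> s; rewrite in_itv/= => /andP[s0 st].
  have d1 : is_derive s 1 (fun s : R => (1 + s) `^ p) (p * (1 + s) `^ (p - 1) * 1).
    apply: is_derive_powR_comp; first lra.
    by apply: is_derive_eq; lra.
  have d2 : is_derive s 1 (fun s : R => (1 - s) `^ p) (p * (1 - s) `^ (p - 1) * -1).
    apply: is_derive_powR_comp; first lra.
    by apply: is_derive_eq; lra.
  rewrite /F; apply: is_derive_eq.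
  rewrite /GRing.scale/=; lra.
- have c1 : {within `[0, t], continuous (fun s : R => (1 + s) `^ p)}.
    apply: within_continuous_powR => //.
      by move=> x; apply: continuousD => //; exact: cst_continuous.
    by move=> x; rewrite in_itv/= => /andP[? ?]; lra.
  have c2 : {within `[0, t], continuous (fun s : R => (1 - s) `^ p)}.
    apply: within_continuous_powR => //.
      by move=> x; apply: continuousB => //; exact: cst_continuous.
    by move=> x; rewrite in_itv/= => /andP[? ?]; lra.
  have c3 : {within `[0, t], continuous (fun s : R => K * s ^+ 2)}.
    apply: continuous_subspaceT => x.
    by apply: cvgM; [exact: cvg_cst|exact: exprn_continuous].
  move=> x; apply: cvgD; last exact: c3.
  apply: cvgM; first exact: cvg_cst.
  by apply: cvgD; [exact: c1|exact: c2].
Qed.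

(** Companion of [symm_powR_ge] for the difference that occurs in its hypothesis:
    together they integrate twice a bound on a second derivative. *)
Lemma asymm_powR_ge e K q t : 0 <= t -> t < 1 ->
  (forall s, 0 < s < t ->
     0 <= e * (q * ((1 + s) `^ (q - 1) + (1 - s) `^ (q - 1))) + K) ->
  0 <= e * ((1 + t) `^ q - (1 - t) `^ q) + K * t.
Proof.
move=> t0 t1 H.
pose F (s : R) := e * ((1 + s) `^ q - (1 - s) `^ q) + K * s.
have dF (s : R) : -1 < s -> s < 1 -> is_derive s 1 F
    (e * (q * ((1 + s) `^ (q - 1) + (1 - s) `^ (q - 1))) + K).
  move=> s0 s1.
  have d1 : is_derive s 1 (fun s : R => (1 + s) `^ q) (q * (1 + s) `^ (q - 1) * 1).
    apply: is_derive_powR_comp; first lra.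
    by apply: is_derive_eq; lra.
  have d2 : is_derive s 1 (fun s : R => (1 - s) `^ q) (q * (1 - s) `^ (q - 1) * -1).
    apply: is_derive_powR_comp; first lra.
    by apply: is_derive_eq; lra.
  rewrite /F; apply: is_derive_eq.
  rewrite /GRing.scale/=; lra.
have : F 0 <= F t; last first.
  by rewrite /F addr0 subr0 powR1 subrr !mulr0 addr0.
apply: (@is_derive_ge0_le _ _
  (fun s => e * (q * ((1 + s) `^ (q - 1) + (1 - s) `^ (q - 1))) + K)) => //.
- by move=> s; rewrite in_itv/= => /andP[s0 st]; apply: dF; lra.
- apply: derivable_within_continuous => s; rewrite in_itv/= => /andP[s0 st].
  by apply: (@ex_derive _ _ _ _ _ _ _ (dF s _ _)); lra.
Qed.

(** The second derivative [p (p - 1) ((1 + t)^(p - 2) + (1 - t)^(p - 2))] is at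
    least [2 p (p - 1)], by Bernoulli's inequality for the exponent
    [p - 2 <= 0]. *)
Lemma two_point_le2 p t : 1 < p -> p <= 2 -> 0 <= t -> t <= 1 ->
  2 + p * (p - 1) * t ^+ 2 <= (1 + t) `^ p + (1 - t) `^ p.
Proof.
move=> p1 p2 t0 t1; have p0 : 0 < p by lra.
suff : 2 * 1 <= 1 * ((1 + t) `^ p + (1 - t) `^ p) + - (p * (p - 1)) * t ^+ 2.
  by lra.
apply: symm_powR_ge => // s /andP[s0 st].
suff : 0 <= 1 * ((1 + s) `^ (p - 1) - (1 - s) `^ (p - 1)) + (- 2 * (p - 1)) * s.
  by move=> /(mulr_ge0 (ltW p0)); lra.
apply: asymm_powR_ge; [lra|lra|] => r /andP[r0 rs]; rewrite mul1r.
have -> : p - 1 - 1 = - (2 - p) by ring.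
have h1 := @powRN_ge_bernoulli R (2 - p) (1 + r).
have h2 := @powRN_ge_bernoulli R (2 - p) (1 - r).
have {}h1 := h1 ltac:(lra) ltac:(lra) ltac:(lra).
have {}h2 := h2 ltac:(lra) ltac:(lra) ltac:(lra).
nra.
Qed.

(** The factor [1 + 2 t] bounds [(1 - s)^(p - 2)] for [s <= t <= 1/2]; it tends to
    [1], so the quadratic coefficient of [two_point_le2] is asymptotically
    exact. *)
Lemma two_point_le2_upper p t : 1 < p -> p <= 2 -> 0 <= t -> t <= 2^-1 ->
  (1 + t) `^ p + (1 - t) `^ p <= 2 + p * (p - 1) * (1 + 2 * t) * t ^+ 2.
Proof.
move=> p1 p2 t0 t1; have p0 : 0 < p by lra.
suff : 2 * -1 <= -1 * ((1 + t) `^ p + (1 - t) `^ p)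
                 + p * (p - 1) * (1 + 2 * t) * t ^+ 2 by lra.
apply: symm_powR_ge; [lra|lra|lra|] => s /andP[s0 st].
suff : 0 <= -1 * ((1 + s) `^ (p - 1) - (1 - s) `^ (p - 1))
            + 2 * (p - 1) * (1 + 2 * t) * s.
  by move=> /(mulr_ge0 (ltW p0)); lra.
apply: asymm_powR_ge; [lra|lra|] => r /andP[r0 rs].
have h1 : (1 + r) `^ (p - 1 - 1) <= 1.
  rewrite -[leRHS](powRr0 (1 + r)); apply: ler_powR; lra.
have h2 : (1 - r) `^ (p - 1 - 1) <= 1 + 2 * t.
  apply: (@le_trans _ _ ((1 - r) `^ (-1))).
    by apply: ger_powR; lra.
  rewrite powR_inv1; last lra.
  by rewrite -[leLHS]mul1r ler_pdivrMr; nra.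
nra.
Qed.

(** The right-hand side is nondecreasing in [s >= 1], since
    [(s + 1)^(p - 1) + (s - 1)^(p - 1) >= 2 s^(p - 1)]; the left-hand side is its
    value at [s = 1]. *)
Lemma symm_powR_ge2 p (s : R) : 2 <= p -> 1 <= s ->
  2 `^ p - 2 <= (s + 1) `^ p + (s - 1) `^ p - 2 * s `^ p.
Proof.
move=> p2 s1; have p0 : 0 < p by lra.
pose F (s : R) := (s + 1) `^ p + (s - 1) `^ p - 2 * s `^ p.
have : F 1 <= F s.
  apply: (@is_derive_ge0_le _ _ (fun s => p * ((s + 1) `^ (p - 1)
           + (s - 1) `^ (p - 1) - 2 * s `^ (p - 1)))) => //.
  - move=> x; rewrite in_itv/= => /andP[x1 xs].
    have d1 : is_derive x 1 (fun s : R => (s + 1) `^ p) (p * (x + 1) `^ (p - 1) * 1).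
      apply: is_derive_powR_comp; first lra.
      by apply: is_derive_eq; lra.
    have d2 : is_derive x 1 (fun s : R => (s - 1) `^ p) (p * (x - 1) `^ (p - 1) * 1).
      apply: is_derive_powR_comp; first lra.
      by apply: is_derive_eq; lra.
    have d3 : is_derive x 1 (fun s : R => s `^ p) (p * x `^ (p - 1)).
      by apply: is_derive1_powR; lra.
    rewrite /F; apply: is_derive_eq.
    rewrite /GRing.scale/=; lra.
  - move=> x; rewrite in_itv/= => /andP[x1 xs]; apply: mulr_ge0; first lra.
    have x0 : 0 < x by lra.
    have -> : x + 1 = x * (1 + x^-1) by field; lra.
    have -> : x - 1 = x * (1 - x^-1) by field; lra.
    have xi0 : 0 < x^-1 by rewrite invr_gt0.
    have xi1 : x^-1 <= 1 by rewrite invf_le1//; lra.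
    rewrite !powRM; [|lra..].
    have h1 := @powR_ge_bernoulli R (p - 1) (1 + x^-1).
    have h2 := @powR_ge_bernoulli R (p - 1) (1 - x^-1).
    have {}h1 := h1 ltac:(lra) ltac:(lra).
    have {}h2 := h2 ltac:(lra) ltac:(lra).
    have := powR_ge0 x (p - 1); nra.
  - have c1 : {within `[1, s], continuous (fun s : R => (s + 1) `^ p)}.
      apply: within_continuous_powR => //.
        by move=> x; apply: continuousD => //; exact: cst_continuous.
      by move=> x; rewrite in_itv/= => /andP[? ?]; lra.
    have c2 : {within `[1, s], continuous (fun s : R => (s - 1) `^ p)}.
      apply: within_continuous_powR => //.
        by move=> x; apply: continuousB => //; exact: cst_continuous.
      by move=> x; rewrite in_itv/= => /andP[? ?]; lra.
    have c3 : {within `[1, s], continuous (fun s : R => s `^ p)}.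
      apply: within_continuous_powR => [//|x|x].
        exact: cvg_id.
      by rewrite in_itv/= => /andP[? ?]; lra.
    move=> x; apply: cvgB.
      by apply: cvgD; [exact: c1|exact: c2].
    by apply: cvgM; [exact: cvg_cst|exact: c3].
by rewrite /F subrr powR0 ?gt_eqF// powR1 addr0 mulr1.
Qed.

(** Equality holds at [t = 0] and at [t = 1]. *)
Lemma two_point_ge2 p t : 2 <= p -> 0 <= t -> t <= 1 ->
  2 + (2 `^ p - 2) * t `^ p <= (1 + t) `^ p + (1 - t) `^ p.
Proof.
move=> p2; rewrite le_eqVlt => /predU1P[<- _|t0 t1].
  by rewrite powR0; [rewrite addr0 subr0 powR1; lra|rewrite gt_eqF//; lra].
have ti : 1 <= t^-1 by rewrite invf_ge1.
have e1 : (1 + t) `^ p = t `^ p * (t^-1 + 1) `^ p.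
  by rewrite -powRM; [congr (_ `^ _); field; lra|lra|lra].
have e2 : (1 - t) `^ p = t `^ p * (t^-1 - 1) `^ p.
  by rewrite -powRM; [congr (_ `^ _); field; lra|lra|lra].
have e3 : t `^ p * t^-1 `^ p = 1 by rewrite -powRM ?mulfV ?powR1//; lra.
have := ler_wpM2l (powR_ge0 t p) (symm_powR_ge2 p2 ti).
rewrite e1 e2 !mulrBr mulrDr (mulrCA _ 2) e3; lra.
Qed.

End two_point.

(** * Integrated two-point inequality *)

(** Apply the hypothesis to [t = |a - b| / (a + b)] and multiply by
    [(a + b)^p]. *)
Lemma two_point_homogeneous (R : realType) (p C1 C2 a b : R) : 0 < p ->
  (forall t, 0 <= t -> t <= 1 ->
     C1 + C2 * t `^ p <= (1 + t) `^ p + (1 - t) `^ p) ->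
  0 <= a -> 0 <= b ->
  C1 * (a + b) `^ p + C2 * `|a - b| `^ p <= 2 `^ p * (a `^ p + b `^ p).
Proof.
move=> p0 H; wlog ba : a b / b <= a.
  move=> W a0 b0; have [ba|/ltW ab] := leP b a; first exact: W.
  by rewrite (addrC a) distrC (addrC (a `^ p)); apply: W.
move=> a0 b0; have [s0|s0] := leP (a + b) 0.
  have -> : a = 0 by lra.
  have -> : b = 0 by lra.
  by rewrite addr0 subr0 normr0 powR0 ?gt_eqF// !mulr0 !addr0 mulr0.
rewrite ger0_norm ?subr_ge0//.
pose t := (a - b) / (a + b).
have t0 : 0 <= t by rewrite divr_ge0//; lra.
have t1 : t <= 1 by rewrite ler_pdivrMr//; lra.
rewrite mulrDr -!powRM; try lra.
have -> : 2 * a = (a + b) * (1 + t) by rewrite /t; field; rewrite gt_eqF.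
have -> : 2 * b = (a + b) * (1 - t) by rewrite /t; field; rewrite gt_eqF.
have -> : a - b = (a + b) * t by rewrite /t; field; rewrite gt_eqF.
rewrite !(powRM _ (ltW s0)); [|lra..].
have := ler_wpM2l (powR_ge0 (a + b) p) (H t t0 t1); lra.
Qed.

Section Lpnorm_theory.
Context d (T : measurableType d) (R : realType).
Variable mu : {measure set T -> \bar R}.
Implicit Types (p : R) (f g u v : T -> R).

Lemma Lfun_measurable p f : f \in Lfun mu p%:E -> measurable_fun setT f.
Proof. by rewrite inE => /andP[/[!inE]]. Qed.

Lemma Lpnorm_fin p f : f \in Lfun mu p%:E ->
  ('N[mu]_(p%:E)[EFin \o f])%E \is a fin_num.
Proof.
rewrite inE => /andP[_ /[!inE]/= lf].
by rewrite ge0_fin_numE ?Lnorm_ge0.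
Qed.

Lemma Lpnorm_ge0 p f : 0 <= Lpnorm mu p f.
Proof. by rewrite /Lpnorm fine_ge0 // Lnorm_ge0. Qed.

Lemma Lpnorm_powR p f : 1 <= p -> f \in Lfun mu p%:E ->
  Lpnorm mu p f `^ p = (\int[mu]_x (`|f x| `^ p))%R.
Proof.
move=> p1 lf; have p0 : p != 0 by rewrite gt_eqF//; lra.
by rewrite /Lpnorm -fine_poweR powR_Lnorm.
Qed.

Lemma Lfun_comb p f g a b : 1 <= p ->
  f \in Lfun mu p%:E -> g \in Lfun mu p%:E ->
  (fun x => a * f x + b * g x) \in Lfun mu p%:E.
Proof.
move=> p1 lf lg; have p1' : (1 <= p%:E)%E by rewrite lee_fin.
have [z H] := @Lfun_submod_closed _ T R mu _ p1'.
have -> : (fun x => a * f x + b * g x) = a *: f + (b *: g + 0).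
  by apply/funext => x; rewrite addr0.
by apply: (H a f _ lf); apply: (H b g _ lg).
Qed.

Lemma Lfun_add p f g : 1 <= p -> f \in Lfun mu p%:E -> g \in Lfun mu p%:E ->
  (fun x => f x + g x) \in Lfun mu p%:E.
Proof.
move=> p1 lf lg; have := Lfun_comb 1 1 p1 lf lg.
by under eq_fun do rewrite !mul1r.
Qed.

Lemma Lfun_sub p f g : 1 <= p -> f \in Lfun mu p%:E -> g \in Lfun mu p%:E ->
  (fun x => f x - g x) \in Lfun mu p%:E.
Proof.
move=> p1 lf lg; have := Lfun_comb 1 (-1) p1 lf lg.
by under eq_fun do rewrite mul1r mulN1r.
Qed.

Lemma Lfun_cstM p a f : 1 <= p -> f \in Lfun mu p%:E ->
  (fun x => a * f x) \in Lfun mu p%:E.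
Proof.
move=> p1 lf; have := Lfun_comb a 0 p1 lf lf.
by under eq_fun do rewrite mul0r addr0.
Qed.

Lemma LpnormN p f : Lpnorm mu p (fun x => - f x) = Lpnorm mu p f.
Proof.
by rewrite /Lpnorm (_ : EFin \o _ = \- (EFin \o f))%E// oppe_Lnorm.
Qed.

Lemma LpnormZ p a f : 1 <= p -> 0 <= a -> f \in Lfun mu p%:E ->
  Lpnorm mu p (fun x => a * f x) = a * Lpnorm mu p f.
Proof.
move=> p1 a0 lf; have p1' : (1 <= p%:E)%E by rewrite lee_fin.
have := @LnormZ _ T R mu _ p1' (Lfun_Sub p1' lf) a.
by rewrite /Lpnorm => -> ; rewrite ger0_norm// fineM// Lpnorm_fin.
Qed.

Lemma LpnormD p f g : 1 <= p -> f \in Lfun mu p%:E -> g \in Lfun mu p%:E ->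
  Lpnorm mu p (fun x => f x + g x) <= Lpnorm mu p f + Lpnorm mu p g.
Proof.
move=> p1 lf lg; have p1' : (1 <= p%:E)%E by rewrite lee_fin.
exact: (@ler_LnormD _ T R mu _ p1' (Lfun_Sub p1' lf) (Lfun_Sub p1' lg)).
Qed.

Lemma Lpnorm_ae_eq p f g : measurable_fun setT f -> measurable_fun setT g ->
  {ae mu, forall x, f x = g x} -> Lpnorm mu p f = Lpnorm mu p g.
Proof.
move=> mf mg fg; rewrite /Lpnorm unlock; congr (fine (_ `^ _)).
have mp (h : T -> R) : measurable_fun setT h ->
    measurable_fun setT (EFin \o (fun x => `|h x| `^ p)).
  move=> mh; apply/measurable_EFinP.
  by apply: (measurableT_comp (measurable_powR p)); exact: measurableT_comp.
apply: ae_eq_integral => //; [exact: mp mf|exact: mp mg|].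
by apply: filterS fg => x /= ->.
Qed.

(** The coefficients [C1] and [C2] may depend on [u] and [v] and may be negative;
    this freedom is used when [p <= 2]. *)
Lemma Lpnorm_two_point p (C1 C2 : R) u v : 1 <= p ->
  u \in Lfun mu p%:E -> v \in Lfun mu p%:E ->
  (forall x, 0 <= u x) -> (forall x, 0 <= v x) ->
  (forall t, 0 <= t -> t <= 1 ->
     C1 + C2 * t `^ p <= (1 + t) `^ p + (1 - t) `^ p) ->
  C1 * Lpnorm mu p (fun x => u x + v x) `^ p
    + C2 * Lpnorm mu p (fun x => u x - v x) `^ p
  <= 2 `^ p * (Lpnorm mu p u `^ p + Lpnorm mu p v `^ p).
Proof.
move=> p1 lu lv u0 v0 H.
have ls := Lfun_add p1 lu lv; have ld := Lfun_sub p1 lu lv.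
rewrite !Lpnorm_powR//.
have iD (h k : T -> R) : mu.-integrable setT (EFin \o h) ->
    mu.-integrable setT (EFin \o k) ->
    mu.-integrable setT (EFin \o (fun x => h x + k x)).
  exact: integrableD.
have iZ (c : R) (h : T -> R) : mu.-integrable setT (EFin \o h) ->
    mu.-integrable setT (EFin \o (fun x => c * h x)).
  exact: integrableZl.
have is_ := Lfun_integrable p1 ls.
have id_ := Lfun_integrable p1 ld.
have iu := Lfun_integrable p1 lu.
have iv := Lfun_integrable p1 lv.
rewrite -RintegralD// -!RintegralZl//; last exact: iD.
rewrite -RintegralD//; [|exact: iZ..].
apply: le_Rintegral => //.
- by apply: iD; exact: iZ.
- by apply: iZ; exact: iD.
- move=> x _; rewrite (ger0_norm (u0 x)) (ger0_norm (v0 x)).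
  rewrite (ger0_norm (addr_ge0 (u0 x) (v0 x))).
  by apply: two_point_homogeneous => //; lra.
Qed.

End Lpnorm_theory.

(** * The refined inequality *)

(** The concave function [x |-> x^(p / 2)] lies below its tangent at [rho^2];
    take [x = t^2]. *)
Lemma powR_le_tangent (R : realType) (p rho t : R) :
  0 <= p -> p <= 2 -> 0 < rho -> 0 <= t ->
  2 * rho `^ (2 - p) * t `^ p <= 2 * rho ^+ 2 + p * (t ^+ 2 - rho ^+ 2).
Proof.
move=> p0 p2 r0 t0.
have h := @powR_le_bernoulli R (p / 2) ((t / rho) ^+ 2).
have {}h := h ltac:(lra) ltac:(lra) (sqr_ge0 _).
have E2 : rho ^+ 2 != 0 by rewrite expf_neq0// gt_eqF.
rewrite -[X in X <= _]mulrA.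
have -> : rho `^ (2 - p) * t `^ p = rho ^+ 2 * (t / rho) `^ p.
  rewrite powRB; last by rewrite (gt_eqF r0) implybT.
  rewrite powR_mulrn ?(ltW r0)// powRM ?invr_ge0 ?(ltW r0)//.
  have -> : rho^-1 `^ p = (rho `^ p)^-1.
    by rewrite -powR_inv1 ?(ltW r0)// -powRrM mulN1r powRN.
  by rewrite mulrAC mulrA.
have <- : ((t / rho) ^+ 2) `^ (p / 2) = (t / rho) `^ p.
  rewrite -powR_mulrn; last by rewrite divr_ge0// ltW.
  by rewrite -powRrM; congr (_ `^ _); field.
have := ler_wpM2l (sqr_ge0 rho) h.
have -> : (t / rho) ^+ 2 = t ^+ 2 / rho ^+ 2 by rewrite expr_div_n.
have -> : rho ^+ 2 * (1 + p / 2 * (t ^+ 2 / rho ^+ 2 - 1)) =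
  rho ^+ 2 + p / 2 * (t ^+ 2 - rho ^+ 2) by field; rewrite gt_eqF.
lra.
Qed.

Section refined_triangle.
Context d (T : measurableType d) (R : realType).
Variable mu : {measure set T -> \bar R}.
Implicit Types (p : R) (f g u v : T -> R).

Lemma Lpnorm_unit_le p u v : 1 < p ->
  u \in Lfun mu p%:E -> v \in Lfun mu p%:E ->
  (forall x, 0 <= u x) -> (forall x, 0 <= v x) ->
  Lpnorm mu p u = 1 -> Lpnorm mu p v = 1 ->
  Lpnorm mu p (fun x => u x + v x) <=
    2 - c_p p * Lpnorm mu p (fun x => u x - v x) `^ alpha_p p.
Proof.
move=> p1 lu lv u0 v0 u1 v1; have p1' := ltW p1; have p0 : 0 < p by lra.
have S2 := LpnormD p1' lu lv.
have lvN : (fun x => - v x) \in Lfun mu p%:E.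
  by under eq_fun do rewrite -mulN1r; exact: Lfun_cstM.
have E2 := LpnormD p1' lu lvN.
rewrite u1 v1 in S2; rewrite u1 LpnormN v1 in E2.
have two := fun C1 C2 => @Lpnorm_two_point _ _ _ mu p C1 C2 u v p1' lu lv u0 v0.
rewrite u1 v1 powR1 in two.
move: S2 E2 two (Lpnorm_ge0 mu p (fun x => u x + v x))
  (Lpnorm_ge0 mu p (fun x => u x - v x)).
move: (Lpnorm mu p (fun x => u x + v x)) (Lpnorm mu p (fun x => u x - v x)).
move=> S E S2 E2 two S0 E0.
pose m := S / 2.
have m0 : 0 <= m by rewrite /m; lra.
have bern := @powR_ge_bernoulli R p m p1' m0.
have Sm : S `^ p = 2 `^ p * m `^ p.
  by rewrite -powRM //; congr (_ `^ _); rewrite /m; field.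
have P2 : 0 < (2 : R) `^ p by rewrite powR_gt0.
rewrite /c_p /alpha_p; have [p2|p2] := leP p 2.
- rewrite powR_mulrn//.
  (* The tangent point [E / S] is only available for [S], [E] nonzero. *)
  have [S_eq0|S_neq0] := eqVneq S 0; first by nra.
  have [E_eq0|E_neq0] := eqVneq E 0; first by rewrite E_eq0; lra.
  have Sgt0 : 0 < S by rewrite lt_def S_neq0.
  have Egt0 : 0 < E by rewrite lt_def E_neq0.
  pose rho := E / S.
  have r0 : 0 < rho by rewrite divr_gt0.
  (* The tangent bound of [t^2] in terms of [t^p], inserted in the quadratic
     two-point inequality. *)
  have := two (2 + p * (p - 1) * rho ^+ 2 - 2 * (p - 1) * rho ^+ 2)
    (2 * (p - 1) * rho `^ (2 - p)).
  have -> : E = rho * S by rewrite /rho divfK.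
  rewrite (powRM _ (ltW r0) S0).
  have rr : rho `^ (2 - p) * rho `^ p = rho ^+ 2.
    by rewrite -powRD ?subrK ?powR_mulrn ?(ltW r0)// (gt_eqF r0) implybT.
  (* Together with [rho * m = E / 2], this bounds [rho^2 m^p] below by
     [E^2 / 4]. *)
  have mm : m ^+ 2 <= m `^ p.
    rewrite -powR_mulrn//; apply: ger_powR => //; rewrite /m; lra.
  move=> H.
  have {}H : (2 + p * (p - 1) * rho ^+ 2) * m `^ p <= 2.
    rewrite -(ler_pM2l P2); rewrite Sm in H.
    have tangent t : 0 <= t -> t <= 1 ->
        2 + p * (p - 1) * rho ^+ 2 - 2 * (p - 1) * rho ^+ 2
          + 2 * (p - 1) * rho `^ (2 - p) * t `^ p <= (1 + t) `^ p + (1 - t) `^ p.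
      move=> t0 t1.
      have := @two_point_le2 R p t p1 p2 t0 t1.
      have := @powR_le_tangent R p rho t (ltW p0) p2 r0 t0.
      nra.
    have := H tangent.
    have -> : 2 * (p - 1) * rho `^ (2 - p) * (rho `^ p * (2 `^ p * m `^ p)) =
        2 * (p - 1) * (rho `^ (2 - p) * rho `^ p) * (2 `^ p * m `^ p) by ring.
    rewrite rr; lra.
  have : 2 * m `^ p + p * (p - 1) * (rho ^+ 2 * m ^+ 2) <= 2.
    have : 0 <= p * (p - 1) * rho ^+ 2.
      by apply: mulr_ge0; [apply: mulr_ge0; lra|exact: sqr_ge0].
    nra.
  have -> : rho ^+ 2 * m ^+ 2 = (rho * S) ^+ 2 / 4 by rewrite /m; field.
  move=> K; rewrite -(ler_pM2l p0); rewrite /m in bern K *; lra.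
- have := two 2 (2 `^ p - 2) (fun t => @two_point_ge2 R p t (ltW p2)).
  have -> : (2 : R) `^ (1 - p) = 2 / 2 `^ p.
    by rewrite powRB ?powRr1// pnatr_eq0 implybT.
  rewrite Sm => K.
  have {}K : m `^ p + (1 - 2 / 2 `^ p) * E `^ p / 2 <= 1.
    rewrite -(ler_pM2l P2).
    have -> : 2 `^ p * (m `^ p + (1 - 2 / 2 `^ p) * E `^ p / 2) =
       2 `^ p * m `^ p + (2 `^ p - 2) * E `^ p / 2 by field; rewrite gt_eqF.
    lra.
  rewrite -(ler_pM2l p0) mulrBr.
  have -> : p * ((1 - 2 / 2 `^ p) / p * E `^ p) = (1 - 2 / 2 `^ p) * E `^ p.
    by field; rewrite !gt_eqF.
  rewrite /m in bern K; lra.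
Qed.

Lemma refined_minkowski_nonneg p f g : 1 < p ->
  f \in Lfun mu p%:E -> g \in Lfun mu p%:E ->
  0 < Lpnorm mu p f -> 0 < Lpnorm mu p g ->
  (forall x, 0 <= f x) -> (forall x, 0 <= g x) ->
  refined_minkowski mu p (c_p p) f g.
Proof.
move=> p1 lf lg; have p1' := ltW p1.
wlog gf : f g lf lg / Lpnorm mu p g <= Lpnorm mu p f.
  move=> W f0 g0 fx gx; have [gf|/ltW fg] := leP (Lpnorm mu p g) (Lpnorm mu p f).
    exact: W.
  have := W g f lg lf fg g0 f0 gx fx; rewrite /refined_minkowski.
  have -> : Lpnorm mu p (fun x => g x / Lpnorm mu p g - f x / Lpnorm mu p f) =
            Lpnorm mu p (fun x => f x / Lpnorm mu p f - g x / Lpnorm mu p g).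
    rewrite /Lpnorm -oppe_Lnorm; congr fine; apply: eq_Lnorm => x /=.
    by rewrite opprB.
  under eq_fun do rewrite addrC.
  by rewrite minC [_ g + _ f]addrC.
move=> f0 g0 fx gx; rewrite /refined_minkowski (min_idPr gf).
set A := Lpnorm mu p f in f0 gf *; set B := Lpnorm mu p g in g0 gf *.
pose u x := A^-1 * f x; pose v x := B^-1 * g x.
have A0 : A != 0 by rewrite gt_eqF.
have B0 : B != 0 by rewrite gt_eqF.
have lu : u \in Lfun mu p%:E by exact: Lfun_cstM.
have lv : v \in Lfun mu p%:E by exact: Lfun_cstM.
have u1 : Lpnorm mu p u = 1.
  by rewrite /u LpnormZ ?invr_ge0 ?ltW// -/A mulVf.
have v1 : Lpnorm mu p v = 1.
  by rewrite /v LpnormZ ?invr_ge0 ?ltW// -/B mulVf.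
have := @Lpnorm_unit_le p u v p1 lu lv _ _ u1 v1.
have -> : (fun x => f x / A - g x / B) = (fun x => u x - v x).
  by apply/funext => x; rewrite /u /v mulrC (mulrC (g x)).
have -> : (fun x => f x + g x) =
    (fun x => (A - B) * u x + B * (u x + v x)).
  by apply/funext => x; rewrite /u /v; field; rewrite A0 B0.
have ls := Lfun_add p1' lu lv.
move=> /(_ _ _)H.
have {}H := H (fun x => mulr_ge0 _ (fx x)) (fun x => mulr_ge0 _ (gx x)).
have {}H := H ltac:(by rewrite invr_ge0 ltW) ltac:(by rewrite invr_ge0 ltW).
have := LpnormD p1' (Lfun_cstM (A - B) p1' lu) (Lfun_cstM B p1' ls).
rewrite (LpnormZ p1' _ lu) ?subr_ge0// (LpnormZ p1' (ltW g0) ls) u1.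
have := ler_wpM2l (ltW g0) H.
lra.
Qed.

(** An almost everywhere nonnegative function agrees almost everywhere with its
    absolute value. *)
Lemma refined_minkowski_ae p f g : 1 < p ->
  f \in Lfun mu p%:E -> g \in Lfun mu p%:E ->
  0 < Lpnorm mu p f -> 0 < Lpnorm mu p g ->
  {ae mu, forall x, 0 <= f x} -> {ae mu, forall x, 0 <= g x} ->
  refined_minkowski mu p (c_p p) f g.
Proof.
move=> p1 lf lg f0 g0 fx gx.
have mf := Lfun_measurable lf.
have mg := Lfun_measurable lg.
have mN (h : T -> R) : measurable_fun setT h -> measurable_fun setT (fun x => `|h x|).
  by move=> mh; exact: measurableT_comp.
have lN h : h \in Lfun mu p%:E -> (fun x => `|h x|) \in Lfun mu p%:E.
  rewrite !inE => /andP[/[!inE]/= mh lh]; apply/andP; split.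
    by rewrite inE/=; exact: mN.
  rewrite inE/= /finite_norm; congr (_ < _)%E: lh.
  by rewrite -Lnorm_abse.
have fE : Lpnorm mu p (fun x => `|f x|) = Lpnorm mu p f.
  by rewrite /Lpnorm -[in RHS]Lnorm_abse.
have gE : Lpnorm mu p (fun x => `|g x|) = Lpnorm mu p g.
  by rewrite /Lpnorm -[in RHS]Lnorm_abse.
have := @refined_minkowski_nonneg p (fun x => `|f x|) (fun x => `|g x|) p1
  (lN _ lf) (lN _ lg).
rewrite /refined_minkowski fE gE => /(_ f0 g0)H.
have {}H := H (fun x => normr_ge0 _) (fun x => normr_ge0 _).
rewrite (@Lpnorm_ae_eq _ _ _ mu p (fun x => f x + g x) (fun x => `|f x| + `|g x|)).
- rewrite (@Lpnorm_ae_eq _ _ _ mu p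
    (fun x => f x / Lpnorm mu p f - g x / Lpnorm mu p g)
    (fun x => `|f x| / Lpnorm mu p f - `|g x| / Lpnorm mu p g)) //.
  + by apply: measurable_funB; apply: measurable_funM.
  + by apply: measurable_funB; apply: measurable_funM => //; exact: mN.
  + by apply: filterS2 fx gx => x fx gx; rewrite !ger0_norm.
- exact: measurable_funD.
- by apply: measurable_funD; exact: mN.
- by apply: filterS2 fx gx => x fx gx; rewrite !ger0_norm.
Qed.

End refined_triangle.

(** * Optimality of the constant *)

Section sharpness.
Variable R : realType.
Implicit Types (p c : R) (h : nat -> R).

Lemma powRVK p (x : R) : p != 0 -> 0 <= x -> (x `^ p^-1) `^ p = x.
Proof. by move=> p0 x0; rewrite -powRrM mulVf// powRr1. Qed.

Lemma powRV_le p (x y : R) : 0 < p -> 0 <= x -> x `^ p^-1 <= y ->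
  0 <= y /\ x <= y `^ p.
Proof.
move=> p0 x0 xy; have y0 := le_trans (powR_ge0 _ _) xy; split => //.
rewrite -[leLHS](powRVK (lt0r_neq0 p0) x0).
by apply: ge0_ler_powR; rewrite ?nnegrE ?powR_ge0// ltW.
Qed.

Lemma Lnorm_counting_finite p h n : 0 < p -> (forall k, (n <= k)%N -> h k = 0) ->
  'N[counting]_(p%:E)[EFin \o h]%E = ((\sum_(k < n) `|h k| `^ p) `^ p^-1)%:E.
Proof.
move=> p0 h0; rewrite Lnorm_counting//.
rewrite (nneseries_split 0 n); last by move=> k _; rewrite poweR_ge0.
rewrite add0n eseries0; last first.
  by move=> k nk _ /=; rewrite h0// normr0 powR0// gt_eqF.
by rewrite adde0 big_mkord sumEFin poweR_EFin.
Qed.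

Lemma Lpnorm_counting_finite p h n : 0 < p -> (forall k, (n <= k)%N -> h k = 0) ->
  Lpnorm counting p h = (\sum_(k < n) `|h k| `^ p) `^ p^-1.
Proof. by move=> p0 h0; rewrite /Lpnorm (Lnorm_counting_finite p0 h0). Qed.

Lemma Lfun_counting_finite p h n : 0 < p -> (forall k, (n <= k)%N -> h k = 0) ->
  h \in Lfun counting p%:E.
Proof.
move=> p0 h0; rewrite inE; apply/andP; split; rewrite inE/=; first by [].
by rewrite /finite_norm (Lnorm_counting_finite p0 h0) ltry.
Qed.

(** The inequality with constant [c] fails for some pair of nonzero nonnegative
    sequences in l^p. *)
Definition counting_counterexample p c : Prop :=
  exists f g : nat -> R, [/\ f \in Lfun counting p%:E, g \in Lfun counting p%:E,
    0 < Lpnorm counting p f /\ 0 < Lpnorm counting p g,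
    (forall x, 0 <= f x) /\ (forall x, 0 <= g x) &
    ~ refined_minkowski counting p c f g].

(** As [t] tends to [0], the two sides for [(1 + t, 1 - t)] and [(1 - t, 1 + t)]
    agree to second order exactly when [c = (p - 1) / 4]. *)
Lemma c_p_optimal_le2 p c : 1 < p -> p <= 2 -> (p - 1) / 4 < c ->
  counting_counterexample p c.
Proof.
move=> p1 p2 hc; have p0 : 0 < p by lra.
pose del := c / ((p - 1) / 4) - 1.
have del0 : 0 < del by rewrite subr_gt0 ltr_pdivlMr ?mul1r//; lra.
have cE : c = (p - 1) / 4 * (1 + del) by rewrite /del; field; lra.
(* Small enough for [4 * t < del] and [t <= 1/2]. *)
pose t := del / (8 * (1 + del)).
have t0 : 0 < t by rewrite divr_gt0//; lra.
have t2 : t <= 2^-1 by rewrite ler_pdivrMr; lra.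
have td : 4 * t < del by rewrite /t mulrA ltr_pdivrMr; nra.
pose f (k : nat) : R := match k with 0%N => 1 + t | 1%N => 1 - t | _ => 0 end.
pose g (k : nat) : R := match k with 0%N => 1 - t | 1%N => 1 + t | _ => 0 end.
have f0 k : (2 <= k)%N -> f k = 0 by case: k => [|[|]].
have g0 k : (2 <= k)%N -> g k = 0 by case: k => [|[|]].
pose N := ((1 + t) `^ p + (1 - t) `^ p) `^ p^-1.
have H0 : 0 < (1 + t) `^ p + (1 - t) `^ p.
  by rewrite ltr_wpDr ?powR_ge0// powR_gt0//; lra.
have N0 : 0 < N by rewrite powR_gt0.
have tN0 : 0 <= 2 * t / N by rewrite divr_ge0//; lra.
have fN : Lpnorm counting p f = N.
  rewrite (Lpnorm_counting_finite p0 f0) !big_ord_recr big_ord0/= add0r.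
  by rewrite !ger0_norm//; lra.
have gN : Lpnorm counting p g = N.
  rewrite (Lpnorm_counting_finite p0 g0) !big_ord_recr big_ord0/= add0r.
  by rewrite addrC !ger0_norm//; lra.
(* The norm of the sequence [(1, 1)]. *)
pose w : R := 2 `^ p^-1.
have w0 : 0 < w by rewrite powR_gt0.
have twice x : 0 <= x -> (x `^ p + x `^ p) `^ p^-1 = w * x.
  move=> x0; have -> : x `^ p + x `^ p = 2 * x `^ p by ring.
  by rewrite powRM ?powR_ge0// -powRrM mulfV ?gt_eqF// powRr1.
have sE : Lpnorm counting p (fun k => f k + g k) = w * 2.
  rewrite (@Lpnorm_counting_finite _ _ 2)//; last first.
    by move=> k k2; rewrite f0// g0// addr0.
  rewrite !big_ord_recr big_ord0/= add0r.
  have -> : 1 + t + (1 - t) = 2 by ring.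
  have -> : 1 - t + (1 + t) = 2 by ring.
  rewrite (ger0_norm (ler0n R 2)).
  exact: (twice 2 (ler0n R 2)).
have dE : Lpnorm counting p (fun k => f k / N - g k / N) = w * (2 * t / N).
  rewrite (@Lpnorm_counting_finite _ _ 2)//; last first.
    by move=> k k2; rewrite f0// g0// !mul0r subr0.
  rewrite !big_ord_recr big_ord0/= add0r.
  have -> : (1 + t) / N - (1 - t) / N = 2 * t / N by ring.
  have -> : (1 - t) / N - (1 + t) / N = - (2 * t / N) by ring.
  rewrite normrN (ger0_norm tN0).
  exact: (twice _ tN0).
exists f, g; split.
- exact: (Lfun_counting_finite p0 f0).
- exact: (Lfun_counting_finite p0 g0).
- by rewrite fN gN.
- by split=> [] [|[|x]] //=; rewrite {fN gN sE dE}; lra.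
rewrite /refined_minkowski fN gN sE dE minxx /alpha_p p2.
rewrite powR_mulrn => [{fN gN sE dE} K|]; last exact: mulr_ge0 (ltW w0) tN0.
(* Dividing by [w] amounts to normalizing the counting measure on two points. *)
pose n := N / w.
have n0 : 0 < n by rewrite divr_gt0.
have NE : N = n * w by rewrite /n divfK// gt_eqF.
have {}K : 1 <= n - 2 * c * t ^+ 2 / n.
  rewrite -(ler_pM2l w0); rewrite NE in K.
  have E : c * (n * w) * (w * (2 * t / (n * w))) ^+ 2 =
     2 * (w * (2 * c * t ^+ 2 / n)) by field; rewrite !gt_eqF.
  by rewrite E in K; lra.
have nn : 2 * c * t ^+ 2 <= n ^+ 2 - n.
  have := ler_wpM2r (ltW n0) K.
  by rewrite mulrBl divfK ?gt_eqF//; lra.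
have np : n `^ p = ((1 + t) `^ p + (1 - t) `^ p) / 2.
  rewrite /n powRM ?invr_ge0 ?(ltW N0) ?(ltW w0)// -powRrM mulVf ?gt_eqF//.
  rewrite powRr1 ?(ltW H0)//; congr (_ * _).
  rewrite -powR_inv1 ?(ltW w0)// -!powRrM.
  have -> : p^-1 * (-1 * p) = -1 by field; rewrite gt_eqF.
  by rewrite powR_inv1.
have bern := @powR_ge_bernoulli R p n (ltW p1) (ltW n0).
have up := @two_point_le2_upper R p t p1 p2 (ltW t0) t2.
have n1 : n - 1 <= (p - 1) / 2 * (1 + 2 * t) * t ^+ 2.
  by rewrite -(ler_pM2l p0); lra.
have wt : (p - 1) / 2 * (1 + 2 * t) * t ^+ 2 <= t.
  apply: (@le_trans _ _ (1 * t ^+ 2)); last by nra.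
  by apply: ler_wpM2r; [exact: sqr_ge0|nra].
have t20 : 0 < t ^+ 2 by rewrite exprn_gt0.
have n1' : 0 <= n - 1.
  rewrite -(pmulr_rge0 _ n0).
  have : 0 <= 2 * c * t ^+ 2 by rewrite mulr_ge0 ?sqr_ge0//; lra.
  lra.
have : 2 * c <= (p - 1) / 2 * (1 + 2 * t) * (1 + t).
  rewrite -(ler_pM2r t20); apply: (le_trans nn).
  have -> : n ^+ 2 - n = (n - 1) * n by ring.
  rewrite mulrAC; apply: ler_pM => //; lra.
rewrite cE.
have : (p - 1) * ((1 + 2 * t) * (1 + t)) <= (p - 1) * (1 + 4 * t).
  by apply: ler_wpM2l; [lra|nra].
have : (p - 1) * (4 * t) < (p - 1) * del by rewrite ltr_pM2l//; lra.
lra.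
Qed.

(** For [(a, b, 0)] and [(a, 0, b)], with [a^p = 1 - s] and [b^p = s], both sides
    are [2 - 2 c s + o(s)] exactly when [c = (1 - 2^(1 - p)) / p]. *)
Lemma c_p_optimal_gt2 p c : 2 < p -> (1 - 2 `^ (1 - p)) / p < c ->
  counting_counterexample p c.
Proof.
move=> p2; have p0 : 0 < p by lra.
have p_neq0 : p != 0 by rewrite gt_eqF.
rewrite ltr_pdivrMr//.
have kE : (2 : R) `^ (1 - p) = 2 / 2 `^ p.
  by rewrite powRB ?powRr1// pnatr_eq0 implybT.
have k0 : 0 < (2 : R) `^ (1 - p) by rewrite powR_gt0.
have k1 : (2 : R) `^ (1 - p) < 1.
  rewrite kE ltr_pdivrMr ?powR_gt0// mul1r -[ltLHS](@powRr1 R)//.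
  rewrite /powR pnatr_eq0/= ltr_expR ltr_pM2r; last by rewrite ln_gt0// ltr1n.
  lra.
set kap := 1 - 2 `^ (1 - p) => hc.
have P2 : 0 < (2 : R) `^ p by rewrite powR_gt0.
have kap0 : 0 < kap by rewrite /kap; lra.
have kap1 : kap < 1 by rewrite /kap; lra.
have c0 : 0 < c by nra.
(* Small enough for [kap * (c * p) * s < c * p - kap]. *)
pose s := (c * p - kap) / (2 * (c * p)).
have cp0 : 0 < c * p by rewrite mulr_gt0.
have s0 : 0 < s by rewrite divr_gt0//; lra.
have s1 : s < 1 by rewrite ltr_pdivrMr; lra.
have s20 : 0 <= 2 * s by lra.
have L0 : 0 <= 2 `^ p * (1 - s) + 2 * s.
  by apply: addr_ge0 => //; apply: mulr_ge0; [exact: ltW|lra].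
pose a := (1 - s) `^ p^-1; pose b := s `^ p^-1.
have a0 : 0 <= a by exact: powR_ge0.
have b0 : 0 <= b by exact: powR_ge0.
have ap : a `^ p = 1 - s by rewrite powRVK//; lra.
have bp : b `^ p = s by rewrite powRVK//; lra.
pose f (k : nat) : R := match k with 0%N => a | 1%N => b | _ => 0 end.
pose g (k : nat) : R := match k with 0%N => a | 2%N => b | _ => 0 end.
have f0 k : (3 <= k)%N -> f k = 0 by case: k => [|[|[|]]].
have g0 k : (3 <= k)%N -> g k = 0 by case: k => [|[|[|]]].
have z0 : (0 : R) `^ p = 0 by rewrite powR0// gt_eqF.
have fN : Lpnorm counting p f = 1.
  rewrite (Lpnorm_counting_finite p0 f0) !big_ord_recr big_ord0/= add0r.
  by rewrite normr0 (ger0_norm a0) (ger0_norm b0) ap bp z0 addr0 subrK powR1.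
have gN : Lpnorm counting p g = 1.
  rewrite (Lpnorm_counting_finite p0 g0) !big_ord_recr big_ord0/= add0r.
  by rewrite normr0 (ger0_norm a0) (ger0_norm b0) ap bp z0 addr0 subrK powR1.
have sE : Lpnorm counting p (fun k => f k + g k) =
    (2 `^ p * (1 - s) + 2 * s) `^ p^-1.
  rewrite (@Lpnorm_counting_finite _ _ 3)//; last first.
    by move=> k k3; rewrite f0// g0// addr0.
  rewrite !big_ord_recr big_ord0/= !add0r addr0.
  rewrite (ger0_norm (addr_ge0 a0 a0)) (ger0_norm b0); congr (_ `^ _).
  have -> : a + a = 2 * a by ring.
  by rewrite (powRM _ (ler0n R 2) a0) ap bp; ring.
have dE : Lpnorm counting p (fun k => f k / 1 - g k / 1) = (2 * s) `^ p^-1.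
  rewrite (@Lpnorm_counting_finite _ _ 3)//; last first.
    by move=> k k3; rewrite f0// g0// !mul0r subr0.
  rewrite !big_ord_recr big_ord0/= !add0r !divr1 subrr subr0 sub0r normrN.
  rewrite normr0 (ger0_norm b0) z0 bp; congr (_ `^ _); ring.
exists f, g; split.
- exact: (Lfun_counting_finite p0 f0).
- exact: (Lfun_counting_finite p0 g0).
- by rewrite fN gN.
- by split=> [] [|[|[|x]]] //=.
rewrite /refined_minkowski fN gN sE dE minxx /alpha_p (lt_geF p2).
rewrite (powRVK p_neq0 s20).
move=> {fN gN sE dE ap bp z0} K.
have {}K : (2 `^ p * (1 - s) + 2 * s) `^ p^-1 <= 2 * (1 - c * s).
  apply: (le_trans K); rewrite {K} mulr1; lra.
have [cs1' K2] := powRV_le p0 L0 K.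
have cs1 : 0 <= 1 - c * s by lra.
have cs0 : 0 < c * s by rewrite mulr_gt0.
have {K2}K : 1 - kap * s <= (1 - c * s) `^ p.
  rewrite -(ler_pM2l P2) -(powRM _ (ler0n R 2) cs1); apply: le_trans K2.
  have -> : 2 `^ p * (1 - kap * s) = 2 `^ p * (1 - s) + 2 * s.
    by rewrite /kap kE; field; rewrite gt_eqF.
  exact: lexx.
(* [(1 - x)^p (1 + p x) <= (1 - x)^p (1 + x)^p <= 1] with [x = c s]. *)
have {K} : (1 - kap * s) * (1 + c * p * s) <= 1.
  apply: (@le_trans _ _ ((1 - c * s) `^ p * (1 + c * s) `^ p)).
    apply: ler_pM => //; [nra|nra|].
    have := @powR_ge_bernoulli R p (1 + c * s).
    move=> /(_ ltac:(lra) ltac:(lra)); lra.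
  rewrite -powRM; [|lra|lra].
  apply: (@le_trans _ _ (1 `^ p)); last by rewrite powR1.
  by apply: ge0_ler_powR; rewrite ?nnegrE; nra.
have -> : (1 - kap * s) * (1 + c * p * s) =
  1 + s * (c * p - kap - kap * ((c * p) * s)) by ring.
have -> : c * p * s = (c * p - kap) / 2 by rewrite /s; field; rewrite !gt_eqF.
move=> K.
have : s * (c * p - kap - kap * ((c * p - kap) / 2)) <= 0 by lra.
rewrite pmulr_rle0//; nra.
Qed.

End sharpness.

Unset Implicit Arguments.

Theorem theorem2 (R : realType) (p : R) (hp : 1 < p) :
  (forall (d : measure_display) (T : measurableType d)
      (mu : {measure set T -> \bar R}) (f g : T -> R),
    f \in Lfun mu p%:E -> g \in Lfun mu p%:E ->
    0 < Lpnorm mu p f -> 0 < Lpnorm mu p g ->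
    {ae mu, forall x, 0 <= f x} -> {ae mu, forall x, 0 <= g x} ->
    refined_minkowski mu p (c_p p) f g)
  /\
  ~ (exists2 c : R, c_p p < c &
      forall (d : measure_display) (T : measurableType d)
        (mu : {measure set T -> \bar R}) (f g : T -> R),
      f \in Lfun mu p%:E -> g \in Lfun mu p%:E ->
      0 < Lpnorm mu p f -> 0 < Lpnorm mu p g ->
      {ae mu, forall x, 0 <= f x} -> {ae mu, forall x, 0 <= g x} ->
      refined_minkowski mu p c f g).
Proof.
split; first by move=> d T mu f g; exact: refined_minkowski_ae.
move=> [c cpc H].
have [f [g [lf lg [f0 g0] [fx gx]]]] : counting_counterexample p c.
  move: cpc; rewrite /c_p; have [p2|p2] := leP p 2.
    exact: c_p_optimal_le2.
  exact: c_p_optimal_gt2.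
by apply; apply: H => //; exact: aeW.
Qed.
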